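(* Let $L$ be the topological space, $\pi:L\to N_{\mathbb{R}}=\mathbb{R}^2$ the projection map and $\varphi:L\to\mathbb{R}$ the function constructed in the context from the six cones $\sigma_k^{\pm}$ and the six linear functions $\varphi_k^{\pm}$ ($k=0,1,2$). Then $\mathbb{L}:=(L,\pi,\varphi)$ is a (rank $2$) tropical Lagrangian multi-section over $B=N_{\mathbb{R}}$.
   Context: Definition. Let $B$ be an $n$-dimensional integral affine manifold without boundary. A rank $r$ tropical Lagrangian multi-section is a triple $(L,\pi,\varphi)$ where: (a) $L$ is a topological manifold; (b) $\pi:L\to B$ is a (branched) covering map of degree $r$ whose branch locus $S\subset B$ and ramification locus $S'\subset L$ are unions of locally closed submanifolds of codimension at least $2$; (c) $\varphi=\{\varphi_U\}$ is a collection of local continuous functions on $L$ such that on any two affine charts $U,V\subset L\setminus S'$ (with respect to the affine structure on $L\setminus S'$ induced via $\pi$) one has $\varphi_U-\varphi_V=\langle m,x\rangle+b$ for some $m\in\mathbb{Z}^n$, $b\in\mathbb{R}$. A single globally defined continuous function $\varphi$ on $L$ is regarded as such a collection by restriction. Construction. Let $N=\mathbb{Z}^2$ and $N_{\mathbb{R}}=\mathbb{R}^2$ with coordinates $(\xi^1,\xi^2)$ and its standard integral affine structure. Let $v_0=(1,1)$, $v_1=(-1,0)$, $v_2=(0,-1)$, and let $\sigma_0=\mathbb{R}_{\ge0}\langle v_1,v_2\rangle$, $\sigma_1=\mathbb{R}_{\ge0}\langle v_0,v_2\rangle$, $\sigma_2=\mathbb{R}_{\ge0}\langle v_0,v_1\rangle$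 (the maximal cones of the fan of $\mathbb{P}^2$). For each $k$ let $\sigma_k^{+},\sigma_k^{-}$ be two copies of $\sigma_k$, and define linear functions $\varphi_k^{\pm}:\sigma_k^{\pm}\to\mathbb{R}$ by $$\varphi_0^-=-\xi^1,\quad \varphi_1^+=\xi^1,\quad \varphi_2^-=\xi^2,\quad \varphi_0^+=-\xi^2,\quad \varphi_1^-=\xi^1-\xi^2,\quad \varphi_2^+=\xi^2-\xi^1 .$$ The space $L$ is obtained from the disjoint union of the six cones $\sigma_k^{\pm}$ by gluing $\sigma_0^{\pm}$ with $\sigma_1^{\mp}$ along the ray $\mathbb{R}_{\ge0}v_2$, $\sigma_0^{\pm}$ with $\sigma_2^{\mp}$ along the ray $\mathbb{R}_{\ge0}v_1$, and $\sigma_1^{\pm}$ with $\sigma_2^{\mp}$ along the ray $\mathbb{R}_{\ge0}v_0$. The map $\pi:L\to N_{\mathbb{R}}$ is induced by the identity maps $\sigma_k^{\pm}\to\sigma_k$, and $\varphi$ is the function on $L$ whose restriction to $\sigma_k^{\pm}$ is $\varphi_k^{\pm}$. *)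

(* Defs.v *)
From HB Require Import structures.
From Stdlib Require Import Relation_Operators.
From mathcomp Require Import all_boot all_order all_algebra generic_quotient.
From mathcomp Require Import all_classical all_reals topology normedtype.

Set Implicit Arguments.
Unset Strict Implicit.
Unset Printing Implicit Defensive.

Import Order.TTheory GRing.Theory Num.Theory numFieldNormedType.Exports.

Local Open Scope classical_set_scope.
Local Open Scope ring_scope.

Definition homeo_on (X Y : topologicalType) (U : set X) (V : set Y)
    (f : X -> Y) : Prop :=
  [/\ set_bij U V f, {within U, continuous f} &
      exists2 g : Y -> X, {in U, cancel f g} & {within V, continuous g}].

(* A pair (U, x); only the values of x on U are meaningful. *)
Definition chart (R : realType) (n : nat) (X : topologicalType) : Type :=
  (set X * (X -> 'rV[R]_n))%type.

Definition is_chart (R : realType) (n : nat) (X : topologicalType)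
    (c : chart R n X) : Prop :=
  [/\ open c.1, open (c.2 @` c.1) & homeo_on c.1 (c.2 @` c.1) c.2].

Definition topological_manifold (R : realType) (n : nat) (X : topologicalType)
    : Prop :=
  [/\ hausdorff_space X, @second_countable X &
      forall p : X, exists2 c : chart R n X, is_chart c & c.1 p].

Definition locally_closed (X : topologicalType) (M : set X) : Prop :=
  exists U C : set X, [/\ open U, closed C & M = U `&` C].

(* In the topological category (L carries no smooth structure at its
   ramification points), so M is required to be locally flat in X. *)
Definition locally_closed_submanifold (R : realType) (n : nat)
    (X : topologicalType) (d : nat) (M : set X) : Prop :=
  locally_closed M /\
  forall p, M p -> exists c : chart R n X,
    [/\ is_chart c, c.1 p &
        forall q, c.1 q -> (M q <-> forall i : 'I_n, (d <= i)%N -> c.2 q 0 i = 0)].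

Definition locally_finite (X : topologicalType) (F : set (set X)) : Prop :=
  forall p : X, exists U : set X,
    open_nbhs p U /\ finite_set (F `&` [set M | M `&` U !=set0]).

(* Local finiteness is essential: every subset is a union of points, which are
   submanifolds of codimension n. *)
Definition union_of_submanifolds_codim_ge (R : realType) (n : nat)
    (X : topologicalType) (k : nat) (S : set X) : Prop :=
  exists F : set (set X),
    [/\ locally_finite F, S = \bigcup_(M in F) M &
        forall M, F M -> exists2 d, (d + k <= n)%N &
          locally_closed_submanifold R n d M].

Definition local_homeo_at (X Y : topologicalType) (f : X -> Y) (p : X) : Prop :=
  exists U : set X,
    [/\ open_nbhs p U, open (f @` U) & homeo_on U (f @` U) f].

Definition ramification_locus (X Y : topologicalType) (f : X -> Y) : set X :=
  [set p | ~ local_homeo_at f p].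

Definition branch_locus (X Y : topologicalType) (f : X -> Y) : set Y :=
  f @` ramification_locus f.

Definition evenly_covered (X Y : topologicalType) (f : X -> Y) (r : nat)
    (W : set Y) : Prop :=
  exists V : 'I_r -> set X,
    [/\ forall i, open (V i), trivIset setT V,
        f @^-1` W = \bigcup_i V i & forall i, homeo_on (V i) W f].

(* Unbranched coverings of degree r are the case [branch_locus f = set0]. *)
Definition branched_covering (X Y : topologicalType) (r : nat) (f : X -> Y)
    : Prop :=
  [/\ continuous f,
      forall U, open U -> open (f @` U),
      forall C, closed C -> closed (f @` C),
      forall y, finite_set (f @^-1` [set y]) &
      dense (~` branch_locus f) /\
      forall y, ~ branch_locus f y ->
        exists2 W, open_nbhs y W & evenly_covered f r W].

(* Structure group GL_n(Z) |x R^n. *)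
Definition integral_affine_map (R : realType) (n : nat)
    (f : 'rV[R]_n -> 'rV[R]_n) : Prop :=
  exists2 A : 'M[int]_n, A \in unitmx &
    exists b : 'rV[R]_n, f = fun x => x *m map_mx intr A + b.

(* The coordinate change is locally, hence on each connected component of the
   overlap, an integral affine map. *)
Definition compatible_charts (R : realType) (n : nat) (X : topologicalType)
    (c c' : chart R n X) : Prop :=
  forall p, c.1 p -> c'.1 p ->
    exists2 f, integral_affine_map f & \forall q \near p, c'.2 q = f (c.2 q).

Definition integral_affine_atlas (R : realType) (n : nat)
    (X : topologicalType) (Om : set X) (A : set (chart R n X)) : Prop :=
  [/\ forall c, A c -> is_chart c, \bigcup_(c in A) c.1 = Om &
      forall c c', A c -> A c' -> compatible_charts c c'].

(* Membership in the maximal atlas determined by A. *)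
Definition affine_chart (R : realType) (n : nat) (X : topologicalType)
    (A : set (chart R n X)) (c : chart R n X) : Prop :=
  [/\ is_chart c, c.1 `<=` \bigcup_(c' in A) c'.1 &
      forall c', A c' -> compatible_charts c c' /\ compatible_charts c' c].

Structure integralAffineManifold (R : realType) (n : nat) :=
  IntegralAffineManifold {
    iam_space :> topologicalType ;
    iam_atlas : set (chart R n iam_space) ;
    iam_manifold : topological_manifold R n iam_space ;
    iam_atlasP : integral_affine_atlas setT iam_atlas
  }.

(* For pi : L -> B this is an atlas of L minus the ramification locus. *)
Definition induced_atlas (R : realType) (n : nat)
    (B : integralAffineManifold R n) (L : topologicalType) (pi : L -> B)
    : set (chart R n L) :=
  [set c | [/\ open c.1, open (pi @` c.1), homeo_on c.1 (pi @` c.1) pi &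
     exists2 c0, iam_atlas c0 & pi @` c.1 `<=` c0.1 /\ c.2 = c0.2 \o pi]].

(* A collection of local functions (phi_U), indexed by open sets U; only the
   values of phi_U on U are meaningful. *)
Structure local_functions (R : realType) (L : topologicalType) :=
  LocalFunctions {
    lf_dom : set (set L) ;
    lf_fun : set L -> L -> R
  }.

Definition restrictions (R : realType) (L : topologicalType) (phi : L -> R)
    : local_functions R L :=
  LocalFunctions [set U | open U] (fun=> phi).

Definition local_continuous_functions (R : realType) (L : topologicalType)
    (phi : local_functions R L) : Prop :=
  (forall U, lf_dom phi U -> open U /\ {within U, continuous (lf_fun phi U)}) /\
  \bigcup_(U in lf_dom phi) U = setT.

(* The first conjunct prevents the second one from being vacuous: the affine
   charts on which phi is given cover the complement of the ramification
   locus. *)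
Definition integral_affine_differences (R : realType) (n : nat)
    (B : integralAffineManifold R n) (L : topologicalType) (pi : L -> B)
    (phi : local_functions R L) : Prop :=
  (forall p, ~ ramification_locus pi p ->
     exists U x, [/\ lf_dom phi U, U p & affine_chart (induced_atlas pi) (U, x)])
  /\
  (forall U V x y, lf_dom phi U -> lf_dom phi V ->
     affine_chart (induced_atlas pi) (U, x) ->
     affine_chart (induced_atlas pi) (V, y) ->
     exists (m : 'I_n -> int) (b : R), forall p, U p -> V p ->
       lf_fun phi U p - lf_fun phi V p = \sum_i (m i)%:~R * x p 0 i + b).

Definition tropical_Lagrangian_multisection (R : realType) (n : nat)
    (B : integralAffineManifold R n) (r : nat) (L : topologicalType)
    (pi : L -> B) (phi : local_functions R L) : Prop :=
  [/\ topological_manifold R n L,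
      branched_covering r pi,
      union_of_submanifolds_codim_ge R n 2 (branch_locus pi),
      union_of_submanifolds_codim_ge R n 2 (ramification_locus pi) &
      local_continuous_functions phi /\ integral_affine_differences pi phi].

Section standard.
Variables (R : realType) (n : nat).

Definition std_atlas : set (chart R n 'rV[R]_n) := [set (setT, id)].

Lemma std_is_chart : is_chart ((setT, id) : chart R n 'rV[R]_n).
Proof.
have idT : (@id 'rV[R]_n) @` setT = setT.
  by apply/seteqP; split => // x _; exists x.
split => /=; rewrite ?idT; [exact: openT|exact: openT|].
have cid : {within setT, continuous (@id 'rV[R]_n)}.
  by apply: continuous_subspaceT => x; exact: cvg_id.
split => //; last by exists id.
by split => // y _; exists y.
Qed.

Lemma rV_hausdorff : hausdorff_space 'rV[R]_n.
Proof.
move=> x y xy; apply/rowP => i; apply: Rhausdorff => A B Ax By.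
have [z [Az Bz]] := xy _ _ (coord_continuous Ax) (coord_continuous By).
by exists (z 0 i).
Qed.

Lemma rV_second_countable : @second_countable 'rV[R]_n.
Proof.
pose box (q : 'rV[rat]_n * 'rV[rat]_n) : set 'rV[R]_n :=
  [set x | forall i, ratr (q.1 0 i) < x 0 i < ratr (q.2 0 i)].
have box_open q : open (box q).
  rewrite openE => x qx; exists (fun i j => [set y | ratr (q.1 i j) < y < ratr (q.2 i j)]).
    move=> i j; rewrite (ord1 i).
    have /andP[q1 q2] := qx j.
    apply: filterS2 (lt_nbhsr q1) (lt_nbhsl q2) => y /= y1 y2.
    by rewrite y1 y2.
  by move=> y qy i; exact: qy.
exists (range box); first exact: (sub_countable (card_image_le box setT) (countableP _)).
split; first by move=> _ [q _ <-].
move=> x U [P Px PU].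
have /choice[q qP] : forall i, exists q : rat * rat,
    ratr q.1 < x 0 i < ratr q.2 /\
    [set y : R | ratr q.1 < y < ratr q.2] `<=` P 0 i.
  move=> i; have /nbhs_ballP[e /= e0 eP] := Px 0 i.
  have [q1] := @rat_in_itvoo R (x 0 i - e) (x 0 i) ltac:(by rewrite ltrBlDr ltrDl).
  have [q2] := @rat_in_itvoo R (x 0 i) (x 0 i + e) ltac:(by rewrite ltrDl).
  rewrite !in_itv/= => /andP[h1 h2] /andP[h3 h4].
  exists (q1, q2); split; first by rewrite h4 h1.
  move=> y /= /andP[y1 y2]; apply: eP.
  rewrite /ball/= distrC ltr_distl.
  by rewrite (lt_trans h3 y1) (lt_trans y2 h2).
exists (box (\row_i (q i).1, \row_i (q i).2)).
  split; first by exists (\row_i (q i).1, \row_i (q i).2).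
  by move=> i; rewrite !mxE; case: (qP i).
move=> y qy; apply: PU => i j; rewrite (ord1 i); apply: (qP j).2 => /=.
by have := qy j; rewrite !mxE.
Qed.

Lemma std_manifold : topological_manifold R n 'rV[R]_n.
Proof.
split; [exact: rV_hausdorff|exact: rV_second_countable|].
by move=> p; exists (setT, id) => //; exact: std_is_chart.
Qed.

Lemma std_atlasP : integral_affine_atlas setT std_atlas.
Proof.
split=> [_ ->||_ _ -> -> p _ _]; first exact: std_is_chart.
  by rewrite /std_atlas bigcup_set1.
exists id; last by near=> q.
exists 1%:M; rewrite ?unitmx1//; exists 0; apply/funext => x.
by rewrite map_mx1 mulmx1 addr0.
Unshelve. all: by end_near. Qed.

Definition std_affine : integralAffineManifold R n :=
  IntegralAffineManifold std_manifold std_atlasP.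

End standard.

Section construction.
Variable R : realType.
Local Open Scope quotient_scope.

Definition xi1 (x : 'rV[R]_2) : R := x 0 0.
Definition xi2 (x : 'rV[R]_2) : R := x 0 1.

Definition vec (a b : R) : 'rV[R]_2 := \row_j (if j == 0 then a else b).

Definition ray_gen (k : 'I_3) : 'rV[R]_2 :=
  match val k with
  | 0%N => vec 1 1
  | 1%N => vec (-1) 0
  | _ => vec 0 (-1)
  end.

Definition ray (v : 'rV[R]_2) : set 'rV[R]_2 :=
  [set x | exists2 a : R, 0 <= a & x = a *: v].

Definition cone (v w : 'rV[R]_2) : set 'rV[R]_2 :=
  [set x | exists a b : R, [/\ 0 <= a, 0 <= b & x = a *: v + b *: w]].

Definition idx0 : 'I_3 := @Ordinal 3 0 isT.
Definition idx1 : 'I_3 := @Ordinal 3 1 isT.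
Definition idx2 : 'I_3 := @Ordinal 3 2 isT.

Definition sigma (k : 'I_3) : set 'rV[R]_2 :=
  match val k with
  | 0%N => cone (ray_gen idx1) (ray_gen idx2)
  | 1%N => cone (ray_gen idx0) (ray_gen idx2)
  | _ => cone (ray_gen idx0) (ray_gen idx1)
  end.

(* The sign + is [true], the sign - is [false]. *)
Definition cones : topologicalType :=
  {ks : 'I_3 * bool & set_type (sigma ks.1)}.

Definition cone_index (p : cones) : 'I_3 * bool := projT1 p.
Definition cone_point (p : cones) : 'rV[R]_2 := set_val (projT2 p).

(* Opposite copies of sigma_k and sigma_l, glued along the ray spanned by v_j;
   the choice of s gives both gluings. *)
Definition glue_along (k l j : 'I_3) (p q : cones) : Prop :=
  exists s : bool,
    [/\ cone_index p = (k, s), cone_index q = (l, ~~ s),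
        cone_point p = cone_point q & ray (ray_gen j) (cone_point p)].

Definition glue (p q : cones) : Prop :=
  [\/ glue_along idx0 idx1 idx2 p q, glue_along idx0 idx2 idx1 p q |
      glue_along idx1 idx2 idx0 p q].

Definition glue_rel (p q : cones) : bool := `[< clos_refl_sym_trans _ glue p q >].

Lemma glue_rel_refl : reflexive glue_rel.
Proof. by move=> p; apply/asboolP; exact: rst_refl. Qed.

Lemma glue_rel_sym : symmetric glue_rel.
Proof. by move=> p q; apply/asboolP/asboolP; exact: rst_sym. Qed.

Lemma glue_rel_trans : transitive glue_rel.
Proof.
by move=> q p s /asboolP pq /asboolP qs; apply/asboolP; exact: rst_trans qs.
Qed.

Canonical glue_equiv :=
  EquivRel glue_rel glue_rel_refl glue_rel_sym glue_rel_trans.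

Definition glued := {eq_quot glue_equiv}.
HB.instance Definition _ := Topological.copy glued (quotient_topology glued).
HB.instance Definition _ := Quotient.on glued.

Definition glued_incl (k : 'I_3) (s : bool) (x : set_type (sigma k)) : glued :=
  \pi_glued (existT (fun ks : 'I_3 * bool => set_type (sigma ks.1)) (k, s) x).

Definition phi_lin (ks : 'I_3 * bool) (x : 'rV[R]_2) : R :=
  match val ks.1, ks.2 with
  | 0%N, false => - xi1 x
  | 1%N, true => xi1 x
  | 2%N, false => xi2 x
  | 0%N, true => - xi2 x
  | 1%N, false => xi1 x - xi2 x
  | _, _ => xi2 x - xi1 x
  end.

(* These do not depend on the representative: see [glued_proj_incl] and
   [glued_phi_incl]. *)
Definition glued_proj (p : glued) : std_affine R 2 := cone_point (repr p).

Definition glued_phi (p : glued) : R :=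
  phi_lin (cone_index (repr p)) (cone_point (repr p)).

Lemma glue_inv (p q : cones) : clos_refl_sym_trans _ glue p q ->
  cone_point p = cone_point q /\
  phi_lin (cone_index p) (cone_point p) = phi_lin (cone_index q) (cone_point q).
Proof.
elim=> {p q} [p q|p|p q _ [-> ->]|p q s _ [-> ->] _ [-> ->]] //.
by case=> -[s [-> -> <- [a _ ->]]]; split=> //; rewrite /phi_lin /ray_gen /=;
  case: s; rewrite /= /xi1 /xi2 !mxE /=
    ?(mulr0, mulr1, subrr, oppr0, mulrN, opprK, subr0, sub0r, add0r).
Qed.

Lemma repr_glue (p : cones) :
  clos_refl_sym_trans _ glue (repr (\pi_glued p)) p.
Proof. by apply/asboolP; have /eqquotP := reprK (\pi_glued p). Qed.

Lemma glued_proj_incl (k : 'I_3) (s : bool) (x : set_type (sigma k)) :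
  glued_proj (glued_incl s x) = set_val x.
Proof. exact: (glue_inv (repr_glue _)).1. Qed.

Lemma glued_phi_incl (k : 'I_3) (s : bool) (x : set_type (sigma k)) :
  glued_phi (glued_incl s x) = phi_lin (k, s) (set_val x).
Proof. exact: (glue_inv (repr_glue _)).2. Qed.

End construction.

(* Main.v *)
(* The developing map sends the six cones, Z-linearly, onto the six cones of
   the complete fan with rays +-(1,0), +-(1,1), +-(0,1), in the cyclic order in
   which they are glued; this is a homeomorphism from L onto the plane.  In this
   coordinate two points have the same projection iff they agree up to sign, so L
   carries an involution whose orbits are the fibres of the projection, with the
   origin as its only fixed point.  A closed continuous surjection whose fibres
   are the orbits of an involution of a Hausdorff space is open, a two-sheeted
   covering away from the fixed points, and not locally injective at a fixed
   point that is a limit of moved points.  Since phi is globally continuous, the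
   differences of its restrictions vanish. *)
Require Import Defs.
From Stdlib Require Import Relation_Operators.
From mathcomp Require Import all_boot all_order all_algebra generic_quotient.
From mathcomp Require Import all_classical all_reals topology normedtype.
From mathcomp Require Import ring lra.

Set Implicit Arguments.
Unset Strict Implicit.
Unset Printing Implicit Defensive.

Import Order.TTheory GRing.Theory Num.Theory numFieldNormedType.Exports.

Local Open Scope classical_set_scope.
Local Open Scope ring_scope.

(** * Open and closed maps *)

Definition open_map (X Y : topologicalType) (f : X -> Y) : Prop :=
  forall U, open U -> open (f @` U).

Definition closed_map (X Y : topologicalType) (f : X -> Y) : Prop :=
  forall C, closed C -> closed (f @` C).

Lemma homeo_on_open_map (X Y : topologicalType) (U : set X) (f : X -> Y) :
  U !=set0 -> open U -> continuous f -> open_map f -> set_inj U f ->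
  homeo_on U (f @` U) f.
Proof.
move=> [p Up] oU cf of_ injf.
pose g y := xget p [set x | U x /\ f x = y].
have gf x : U x -> g (f x) = x.
  move=> Ux; rewrite /g; case: xgetP => [z _ [Uz fzx]|/(_ x)]; last by case.
  by apply: injf; rewrite ?inE.
split.
- by split => // x Ux; exists x.
- exact: continuous_subspaceT.
- exists g; first by move=> x; rewrite inE; exact: gf.
  apply/continuousP => A oA; apply/open_subspaceP.
  exists (f @` (U `&` A)); first exact/of_/openI.
  apply/seteqP; split => y [].
    move=> [x [Ux Ax] <-] _; split; last by exists x.
    by change (A (g (f x))); rewrite gf.
  move=> gAy [x Ux xy]; have : A (g y) by [].
  by rewrite -xy gf // => Ax; split; exists x.
Qed.

Lemma bij_closed_open_map (X Y : topologicalType) (f : X -> Y) :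
  bijective f -> closed_map f -> open_map f.
Proof.
move=> [g fK gK] cf U oU.
suff -> : f @` U = ~` (f @` ~` U) by apply/closed_openC/cf/open_closedC.
apply/seteqP; split => [_ [x Ux <-] [z Uz /(can_inj fK) zx]|y nUy].
  by rewrite zx in Uz.
exists (g y) => //; apply: contrapT => nU.
by apply: nUy; exists (g y).
Qed.

(** * Spaces with one global chart, given by an open embedding into affine space *)

Section GlobalChart.
Variables (R : realType) (n : nat) (X : topologicalType) (f : X -> 'rV[R]_n).
Hypotheses (cf : continuous f) (of_ : open_map f) (injf : injective f).

Lemma global_chart (p : X) : is_chart ((setT, f) : chart R n X).
Proof.
split => /=; [exact: openT|exact/of_/openT|].
apply: homeo_on_open_map => //; [by exists p|exact: openT|].
by move=> x y _ _; exact: injf.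
Qed.

(** Separation and a countable base are pulled back along the embedding [f]; openness of [f] is what
    makes the pulled-back base fine enough. *)
Lemma global_chart_manifold : topological_manifold R n X.
Proof.
split.
- move=> x y xy; apply: injf; apply: rV_hausdorff => A B Ax By.
  have [z [Az Bz]] := xy _ _ (cf Ax) (cf By).
  by exists (f z).
- have [B cB [oB bB]] := @rV_second_countable R n.
  exists [set f @^-1` b | b in B].
    exact: sub_countable (card_image_le _ _) cB.
  split.
    move=> _ [b Bb <-]; apply: open_comp; last exact: oB.
    by move=> x _; exact: cf.
  move=> x U; rewrite nbhsE => -[V [oV Vx] VU].
  have /bB[b [Bb bx] bV] : nbhs (f x) (f @` V).
    by apply: open_nbhs_nbhs; split; [exact: of_|exists x].
  exists (f @^-1` b); first by split => //; exists b.
  by move=> z /bV[w Vw /injf wz]; apply: VU; rewrite -wz.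
- by move=> p; exists (setT, f) => //; exact: global_chart.
Qed.

Lemma point_union_of_submanifolds (p : X) (k : nat) : (k <= n)%N -> f p = 0 ->
  union_of_submanifolds_codim_ge R n k [set p].
Proof.
move=> kn fp; exists [set [set p]]; split.
- move=> q; exists setT; split; first by split => //; exact: openT.
  by apply: sub_finite_set (finite_set1 [set p]) => M [].
- by rewrite bigcup_set1.
(* In dimension [0] the slice condition asks all coordinates to vanish, and [f] vanishes only at
   [p]. *)
- move=> _ ->; exists 0%N => //; split.
    exists setT, [set p]; split; rewrite ?setTI //; first exact: openT.
    apply: accessible_closed_set1; apply: hausdorff_accessible.
    by case: global_chart_manifold.
  move=> _ ->; exists (setT, f); split => //; first exact: global_chart.
  move=> q _ /=; split => [-> i _|f0]; first by rewrite fp mxE.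
  by apply: injf; rewrite fp; apply/rowP => i; rewrite mxE f0.
Qed.

End GlobalChart.

(** * Closed maps whose fibres are the orbits of an involution *)

Section InvolutionQuotient.
Variables (X Y : topologicalType) (f : X -> Y) (t : X -> X).
Hypotheses (hX : hausdorff_space X) (cf : continuous f) (ct : continuous t)
  (sf : forall y, exists x, f x = y) (clf : closed_map f)
  (fibf : forall p q, f p = f q <-> q = p \/ q = t p).

Let ft p : f (t p) = f p.
Proof. by apply/esym/fibf; right. Qed.

(** Since [t p] and [p] lie in one fibre, [p] is [t p] or [t (t p)]; in the first case [p] is fixed
    and the claim is immediate. *)
Lemma involution_quotientK : involutive t.
Proof.
move=> p; have /fibf[ptp|//] := ft p.
by rewrite -!ptp.
Qed.
Let tK := involution_quotientK.

Let open_t U : open U -> open (t @^-1` U).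
Proof. by move=> oU; apply: open_comp => // x _; exact: ct. Qed.

(* The complement of [f @` U] is the image of the largest invariant subset of
   the complement of [U], which is closed. *)
Lemma involution_quotient_open : open_map f.
Proof.
move=> U oU.
suff -> : f @` U = ~` (f @` ~` (U `|` t @^-1` U)).
  by apply/closed_openC/clf/open_closedC/openU => //; exact: open_t.
apply/seteqP; split => [_ [x Ux <-] [z nz /fibf[] xz]|y nUy].
  - by apply: nz; left; rewrite -xz.
  - by apply: nz; right; change (U (t z)); rewrite -xz.
have [x xy] := sf y; apply: contrapT => nU; apply: nUy; exists x => //.
by case=> Ux; apply: nU; [exists x|exists (t x); rewrite // ft].
Qed.

Lemma involution_quotient_separated p : t p <> p ->
  exists U, [/\ open_nbhs p U, U `&` t @^-1` U = set0 & set_inj U f].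
Proof.
move=> tp; have := hX; rewrite open_hausdorff => /(_ p (t p)) [].
  by apply/eqP => /esym.
move=> [A B] /= [+ +] [oA oB /eqP AB]; rewrite !inE => Ap Bp.
(* Shrinking [A] to the points that [t] sends into [B] makes it disjoint from its own translate. *)
have UU : (A `&` t @^-1` B) `&` t @^-1` (A `&` t @^-1` B) = set0.
  apply/seteqP; split => // x [[_ Btx] [Atx _]].
  by have : (A `&` B) (t x) by []; rewrite AB.
exists (A `&` t @^-1` B); split => //.
  by split; [apply: openI => //; exact: open_t|split].
move=> x y; rewrite !inE => Ux Uy /fibf[//|ytx]; exfalso.
by suff : set0 x by []; rewrite -UU; split => //=; rewrite /preimage /= -ytx.
Qed.

Lemma involution_quotient_local_homeo p : t p <> p -> local_homeo_at f p.
Proof.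
move=> /involution_quotient_separated[U [oU _ injU]].
exists U; split => //; first exact/involution_quotient_open/oU.1.
apply: homeo_on_open_map => //; [by exists p; exact: oU.2|exact: oU.1|].
exact: involution_quotient_open.
Qed.

(** The two sheets are [U] and its translate by [t]; they are disjoint and have the same image
    because [f] is invariant under [t]. *)
Lemma involution_quotient_evenly_covered p : t p <> p ->
  exists2 W, open_nbhs (f p) W & evenly_covered f 2 W.
Proof.
move=> /involution_quotient_separated[U [[oU Up] UtU injU]].
have imt : f @` (t @^-1` U) = f @` U.
  apply/seteqP; split => _ [x Ux <-]; exists (t x); rewrite ?ft //=.
  by rewrite /preimage /= tK.
exists (f @` U).
  by split; [exact: involution_quotient_open|exists p].
exists (fun i : 'I_2 => if i == 0 then U else t @^-1` U); split.
- by move=> i; case: ifP => _ //; exact: open_t.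
- have ne0 (i : 'I_2) : i != 0 -> i = 1.
    by case: i => [[|[|//]] ?] // _; exact: val_inj.
  have disj x : U x -> U (t x) -> False.
    by move=> Ux tUx; have : (U `&` t @^-1` U) x by []; rewrite UtU.
  move=> i j _ _ [x []].
  by case: (eqVneq i 0) => [->|/ne0 ->]; case: (eqVneq j 0) => [->|/ne0 ->] //=
    => ? ?; case: (disj x).
- apply/seteqP; split => [x [u Uu /fibf [->|->]]|x [i _]].
  + by exists 0.
  + by exists 1 => //=; rewrite /preimage /= tK.
  + by case: ifP => _ Ux; [exists x|exists (t x); rewrite ?ft].
- move=> i; case: ifP => _; [|rewrite -imt]; apply: homeo_on_open_map => //;
    try exact: involution_quotient_open.
  + by exists p.
  + by exists (t p); rewrite /preimage /= tK.
  + exact: open_t.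
  + move=> x y; rewrite !inE => Ux Uy; rewrite -(ft x) -(ft y) => fxy.
    by apply: (can_inj tK); apply: injU; rewrite ?inE.
Qed.

Hypothesis dense_unfixed : dense (~` (f @` [set p | t p = p])).

Lemma involution_quotient_ramification :
  ramification_locus f = [set p | t p = p].
Proof.
apply/seteqP; split => p /=.
  by move=> np; apply: contrapT => /involution_quotient_local_homeo.
move=> tp [U [[oU Up] _ [[_ injU _] _ _]]].
have oV : open (U `&` t @^-1` U) by apply: openI => //; exact: open_t.
have Vp : (U `&` t @^-1` U) p by split => //; rewrite /preimage /= tp.
have [|_ [[q [Uq tUq] <-] nfq]] :=
  dense_unfixed _ (involution_quotient_open oV).
  by exists (f p); exists p.
apply: nfq; exists q => //=; apply: injU; rewrite ?inE //.
Qed.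

Lemma involution_quotient_branched_covering : branched_covering 2 f.
Proof.
split => //.
- exact: involution_quotient_open.
- move=> y; have [x <-] := sf y.
  apply: sub_finite_set (_ : finite_set ([set x] `|` [set t x])).
    by move=> z /= /esym/fibf.
  by rewrite finite_setU; split; exact: finite_set1.
- rewrite /branch_locus involution_quotient_ramification; split => // y ny.
  have [x xy] := sf y; rewrite -xy; apply: involution_quotient_evenly_covered.
  by move=> tx; apply: ny; exists x.
Qed.

End InvolutionQuotient.

(** The standard atlas consists of the identity chart alone, so every chart of the induced atlas has
    [f] itself as coordinate map and all coordinate changes are the identity. Near an unramified
    point [f] therefore serves as the required affine chart. *)
Lemma integral_affine_differences_restrictions (R : realType) (n : nat)
    (X : topologicalType) (f : X -> std_affine R n) (phi : X -> R) :
  integral_affine_differences f (restrictions phi).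
Proof.
split=> [p /contrapT[U [[oU Up] ofU hU]]|U V x y _ _ _ _]; last first.
  exists (fun=> 0), 0 => p _ _ /=.
  by rewrite subrr big1 ?addr0 // => i _; rewrite mul0r.
exists U, f; split => //.
have compat (c c' : chart R n X) :
    c.2 = f -> c'.2 = f -> compatible_charts c c'.
  move=> cE c'E q _ _; exists id; last by rewrite cE c'E; near=> z.
  exists 1%:M; rewrite ?unitmx1 //; exists 0; apply/funext => z.
  by rewrite map_mx1 mulmx1 addr0.
split => //.
- move=> q Uq; exists (U, f : X -> 'rV[R]_n) => //=; split => //.
  by exists (setT, id).
- by move=> c [_ _ _ [_ -> [_ cE]]]; split; apply: compat.
Unshelve. all: by end_near. Qed.

(** * The cones of the fan and the developing map, in plane coordinates *)

Section Plane.
Variable R : realType.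
Implicit Types x y : 'rV[R]_2.

Lemma ord2P (j : 'I_2) : j = 0 \/ j = 1.
Proof. by case: j => [[|[|//]] i]; [left|right]; exact: val_inj. Qed.

Lemma vec_ext x y : xi1 x = xi1 y -> xi2 x = xi2 y -> x = y.
Proof.
move=> e1 e2; by apply/rowP => i; case: (ord2P i) => ->.
Qed.

Lemma xi1_vec (a b : R) : xi1 (vec a b) = a.
Proof. by rewrite /xi1 /vec mxE. Qed.

Lemma xi2_vec (a b : R) : xi2 (vec a b) = b.
Proof. by rewrite /xi2 /vec mxE. Qed.

Lemma xi1Z (a : R) x : xi1 (a *: x) = a * xi1 x.
Proof. by rewrite /xi1 mxE. Qed.

Lemma xi2Z (a : R) x : xi2 (a *: x) = a * xi2 x.
Proof. by rewrite /xi2 mxE. Qed.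

Lemma xi1D x y : xi1 (x + y) = xi1 x + xi1 y.
Proof. by rewrite /xi1 mxE. Qed.

Lemma xi2D x y : xi2 (x + y) = xi2 x + xi2 y.
Proof. by rewrite /xi2 mxE. Qed.

Lemma xi1N x : xi1 (- x) = - xi1 x.
Proof. by rewrite /xi1 mxE. Qed.

Lemma xi2N x : xi2 (- x) = - xi2 x.
Proof. by rewrite /xi2 mxE. Qed.

Lemma xi1_0 : xi1 (0 : 'rV[R]_2) = 0.
Proof. by rewrite /xi1 mxE. Qed.

Lemma xi2_0 : xi2 (0 : 'rV[R]_2) = 0.
Proof. by rewrite /xi2 mxE. Qed.

Definition xiE := (xi1_0, xi2_0, xi1_vec, xi2_vec, xi1Z, xi2Z,
  xi1D, xi2D, xi1N, xi2N).

Lemma xi1_continuous : continuous (@xi1 R).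
Proof. exact: coord_continuous. Qed.

Lemma xi2_continuous : continuous (@xi2 R).
Proof. exact: coord_continuous. Qed.

Lemma vec_continuous (T : topologicalType) (a b : T -> R) :
  continuous a -> continuous b -> continuous (fun p => vec (a p) (b p)).
Proof.
move=> ca cb p A [P Pp PA]; apply: (@filterS _ _ _ [set q |
    P 0 0 (a q) /\ P 0 1 (b q)]).
  move=> q [q1 q2]; apply: PA => i j; rewrite (ord1 i) mxE.
  by case: (ord2P j) => ->.
apply: filterI; [apply: ca|apply: cb].
  by have := Pp 0 0; rewrite mxE.
by have := Pp 0 1; rewrite mxE.
Qed.

Lemma opp_fun_continuous (T : topologicalType) (a : T -> R) :
  continuous a -> continuous (fun p => - a p).
Proof. by move=> ca p; apply: continuousN; exact: ca. Qed.

Lemma sub_fun_continuous (T : topologicalType) (a b : T -> R) :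
  continuous a -> continuous b -> continuous (fun p => a p - b p).
Proof. by move=> ca cb p; apply: continuousB; [exact: ca|exact: cb]. Qed.

Lemma scale_fun_continuous (T : topologicalType) (c : R) (a : T -> R) :
  continuous a -> continuous (fun p => c * a p).
Proof. by move=> ca p; apply: continuousM; [exact: cvg_cst|exact: ca]. Qed.

(** The witnesses are the coordinates of [x] in the basis of ray generators. The inequality form of
    the three cones reduces later case analyses to linear arithmetic. *)
Lemma sigma0E x : sigma idx0 x <-> xi1 x <= 0 /\ xi2 x <= 0.
Proof.
split=> [[a [b [a0 b0 ->]]]|[x1 x2]].
  by rewrite /ray_gen /= !xiE; split; lra.
exists (- xi1 x), (- xi2 x); split; [lra|lra|].
by apply: vec_ext; rewrite /ray_gen /= !xiE; ring.
Qed.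

Lemma sigma1E x : sigma idx1 x <-> 0 <= xi1 x /\ xi2 x <= xi1 x.
Proof.
split=> [[a [b [a0 b0 ->]]]|[x1 x2]].
  by rewrite /ray_gen /= !xiE; split; lra.
exists (xi1 x), (xi1 x - xi2 x); split; [lra|lra|].
by apply: vec_ext; rewrite /ray_gen /= !xiE; ring.
Qed.

Lemma sigma2E x : sigma idx2 x <-> 0 <= xi2 x /\ xi1 x <= xi2 x.
Proof.
split=> [[a [b [a0 b0 ->]]]|[x1 x2]].
  by rewrite /ray_gen /= !xiE; split; lra.
exists (xi2 x), (xi2 x - xi1 x); split; [lra|lra|].
by apply: vec_ext; rewrite /ray_gen /= !xiE; ring.
Qed.

Lemma idxP (k : 'I_3) : [\/ k = idx0, k = idx1 | k = idx2].
Proof.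
case: k => [[|[|[|//]]] i]; [apply: Or31|apply: Or32|apply: Or33]; exact: val_inj.
Qed.

Lemma sigma_closed (k : 'I_3) : closed (@sigma R k).
Proof.
have cl (a b : 'rV[R]_2 -> R) : continuous a -> continuous b ->
    closed [set x | 0 <= a x /\ 0 <= b x].
  move=> ca cb; apply: (@closedI _ (a @^-1` [set r | 0 <= r])
    (b @^-1` [set r | 0 <= r])); apply: preimage_closed; try exact: closed_ge;
    by move=> x _; first [exact: ca|exact: cb].
have c1 := xi1_continuous; have c2 := xi2_continuous.
case: (idxP k) => ->.
- rewrite (_ : sigma _ = [set x | 0 <= - xi1 x /\ 0 <= - xi2 x]).
    by apply: cl; exact: opp_fun_continuous.
  by apply/seteqP; split => x /= => [/sigma0E|] [x1 x2]; [|apply/sigma0E]; split; lra.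
- rewrite (_ : sigma _ = [set x | 0 <= xi1 x /\ 0 <= xi1 x - xi2 x]).
    by apply: cl => //; exact: sub_fun_continuous.
  by apply/seteqP; split => x /= => [/sigma1E|] [x1 x2]; [|apply/sigma1E]; split; lra.
- rewrite (_ : sigma _ = [set x | 0 <= xi2 x /\ 0 <= xi2 x - xi1 x]).
    by apply: cl => //; exact: sub_fun_continuous.
  by apply/seteqP; split => x /= => [/sigma2E|] [x1 x2]; [|apply/sigma2E]; split; lra.
Qed.

(* The developing map on the half of L formed by the sheets 1-, 2+ and 0-, which
   lands in the half-plane above the line of (1,0); [dev] extends it oddly to the
   opposite sheets. *)
Definition dev_half (k : 'I_3) x : 'rV[R]_2 :=
  match val k with
  | 0%N => vec (xi2 x) (- xi1 x)
  | 1%N => vec (2 * xi1 x - xi2 x) (xi1 x)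
  | _ => vec (xi2 x) (2 * xi2 x - xi1 x)
  end.

Definition dev_sign (ks : 'I_3 * bool) : R :=
  if (ks.1 == idx2) == ks.2 then 1 else -1.

Definition dev (ks : 'I_3 * bool) x : 'rV[R]_2 := dev_sign ks *: dev_half ks.1 x.

Definition dev_half_inv (k : 'I_3) y : 'rV[R]_2 :=
  match val k with
  | 0%N => vec (- xi2 y) (xi1 y)
  | 1%N => vec (xi2 y) (2 * xi2 y - xi1 y)
  | _ => vec (2 * xi1 y - xi2 y) (xi1 y)
  end.

(** Each [dev ks] is a linear automorphism of the whole plane, so its inverse is taken globally, not
    only on the image cone. The sign is its own inverse. *)
Definition dev_inv (ks : 'I_3 * bool) y : 'rV[R]_2 :=
  dev_half_inv ks.1 (dev_sign ks *: y).

Lemma dev_sign2 ks : dev_sign ks * dev_sign ks = 1.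
Proof. by rewrite /dev_sign; case: ifP => _; rewrite ?mulrNN mulr1. Qed.

Lemma devK ks : cancel (dev ks) (dev_inv ks).
Proof.
move=> x; rewrite /dev_inv /dev scalerA dev_sign2 scale1r.
by case: (idxP ks.1) => ->; apply: vec_ext; rewrite !xiE; ring.
Qed.

Lemma dev_invK ks : cancel (dev_inv ks) (dev ks).
Proof.
move=> y; rewrite -[RHS]scale1r -(dev_sign2 ks) -scalerA; congr (_ *: _).
rewrite /dev_inv; move: (_ *: y) => z.
by case: (idxP ks.1) => ->; apply: vec_ext; rewrite !xiE; ring.
Qed.

Lemma dev_half_continuous k : continuous (dev_half k).
Proof.
have c1 := xi1_continuous; have c2 := xi2_continuous.
by case: (idxP k) => ->; apply: vec_continuous => //;
  first [exact: opp_fun_continuous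
        |apply: sub_fun_continuous => //; exact: scale_fun_continuous].
Qed.

Lemma dev_half_inv_continuous k : continuous (dev_half_inv k).
Proof.
have c1 := xi1_continuous; have c2 := xi2_continuous.
by case: (idxP k) => ->; apply: vec_continuous => //;
  first [exact: opp_fun_continuous
        |apply: sub_fun_continuous => //; exact: scale_fun_continuous].
Qed.

Lemma dev_continuous ks : continuous (dev ks).
Proof.
have c : continuous ( *:%R (dev_sign ks) \o dev_half ks.1).
  by move=> x; apply: continuous_comp;
    [exact: dev_half_continuous|exact: scaler_continuous].
exact: c.
Qed.

Lemma dev_inv_continuous ks : continuous (dev_inv ks).
Proof.
have c : continuous (dev_half_inv ks.1 \o *:%R (dev_sign ks)).
  by move=> x; apply: continuous_comp;
    [exact: scaler_continuous|exact: dev_half_inv_continuous].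
exact: c.
Qed.

Lemma sigmaE k x : sigma k x ->
  [\/ k = idx0 /\ (xi1 x <= 0 /\ xi2 x <= 0),
      k = idx1 /\ (0 <= xi1 x /\ xi2 x <= xi1 x) |
      k = idx2 /\ (0 <= xi2 x /\ xi1 x <= xi2 x)].
Proof.
by case: (idxP k) => -> => [/sigma0E|/sigma1E|/sigma2E] h;
  [apply: Or31|apply: Or32|apply: Or33].
Qed.

(** Distinct cones meet in a ray. The maps agree on the rays of [v_0] and [v_1]; on that of [v_2],
    shared by cones 0 and 1, they are opposite, since the half-plane is cut open there. *)
Lemma dev_half_overlap k l x : sigma k x -> sigma l x ->
  dev_half l x = dev_half k x \/ dev_half l x = - dev_half k x.
Proof.
move=> /sigmaE[] [-> [p1 p2]] /sigmaE[] [-> [q1 q2]];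
  first [by left; apply: vec_ext; rewrite !xiE; lra
        |by right; apply: vec_ext; rewrite !xiE; lra].
Qed.

(** The three images tile a closed half-plane, which meets its negative only in the boundary line;
    both halves of that line are images of the ray of [v_2]. *)
Lemma dev_half_inj k l x y : sigma k x -> sigma l y ->
  dev_half k x = dev_half l y \/ dev_half k x = - dev_half l y -> x = y.
Proof.
move=> kx ly e.
have : xi1 (dev_half k x) = xi1 (dev_half l y) /\
       xi2 (dev_half k x) = xi2 (dev_half l y) \/
       xi1 (dev_half k x) = - xi1 (dev_half l y) /\
       xi2 (dev_half k x) = - xi2 (dev_half l y).
  by case: e => ->; [left|right; rewrite !xiE].
move: kx ly {e} => /sigmaE[] [-> [p1 p2]] /sigmaE[] [-> [q1 q2]];
  rewrite !xiE => -[] [e1 e2]; apply: vec_ext; lra.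
Qed.

Lemma dev_pm ks x : dev ks x = dev_half ks.1 x \/ dev ks x = - dev_half ks.1 x.
Proof.
by rewrite /dev /dev_sign; case: ifP => _; rewrite ?scaleN1r ?scale1r; [left|right].
Qed.

Lemma dev_overlap ks lr x : sigma ks.1 x -> sigma lr.1 x ->
  dev lr x = dev ks x \/ dev lr x = - dev ks x.
Proof.
move=> kx lx.
by case: (dev_half_overlap kx lx) (dev_pm ks x) (dev_pm lr x) => -> [] -> [] ->;
  rewrite ?opprK; first [left; reflexivity|right; reflexivity].
Qed.

Lemma dev_inj ks lr x y : sigma ks.1 x -> sigma lr.1 y ->
  dev ks x = dev lr y \/ dev ks x = - dev lr y -> x = y.
Proof.
move=> kx ly e; apply: (dev_half_inj kx ly).
case: (dev_pm ks x) (dev_pm lr y) e => -> [] ->; rewrite ?opprK => -[] e;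
  first [by left|by right|by left; apply: oppr_inj
        |by right; apply: oppr_inj; rewrite e opprK].
Qed.

Lemma dev_onto y : exists ks x, sigma ks.1 x /\ dev ks x = y.
Proof.
suff [ks kx] : exists ks, sigma ks.1 (dev_inv ks y).
  by exists ks, (dev_inv ks y); split; rewrite ?dev_invK.
have H ks : sigma ks.1 (dev_inv ks y) -> exists ks, sigma ks.1 (dev_inv ks y).
  by exists ks.
(* The lines [xi1 = 0], [xi2 = 0] and [xi1 = xi2] carry the six rays that bound the image cones, so
   these signs determine the cone; the inconsistent sign patterns are closed by [lra] as well. *)
case: (lerP 0 (xi1 y)) => y1; case: (lerP 0 (xi2 y)) => y2;
  case: (lerP (xi1 y) (xi2 y)) => y12;
  first [by apply: (H (idx0, false));
         apply/sigma0E; rewrite /dev_inv /dev_sign /= !xiE; lra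
        |by apply: (H (idx0, true));
         apply/sigma0E; rewrite /dev_inv /dev_sign /= !xiE; lra
        |by apply: (H (idx1, false));
         apply/sigma1E; rewrite /dev_inv /dev_sign /= !xiE; lra
        |by apply: (H (idx1, true));
         apply/sigma1E; rewrite /dev_inv /dev_sign /= !xiE; lra
        |by apply: (H (idx2, false));
         apply/sigma2E; rewrite /dev_inv /dev_sign /= !xiE; lra
        |by apply: (H (idx2, true));
         apply/sigma2E; rewrite /dev_inv /dev_sign /= !xiE; lra].
Qed.

End Plane.

(** * The glued space: identifications, and maps defined cone by cone *)

Section Glued.
Variable R : realType.
Local Open Scope quotient_scope.

Lemma glued_inclP (p : glued R) :
  exists ks (u : set_type (@sigma R ks.1)), p = glued_incl ks.2 u.
Proof.
elim/quotW: p => -[[k s] u].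
by exists (k, s), u.
Qed.

Lemma glued_incl_glue (p q : cones R) :
  Defs.glue p q -> \pi_(glued R) p = \pi_(glued R) q.
Proof. by move=> pq; apply/eqquotP/asboolP; exact: rst_step. Qed.

Lemma sigmaP (k : 'I_3) (u : set_type (@sigma R k)) : sigma k (set_val u).
Proof. by have := valP u; rewrite inE. Qed.

Lemma glued_incl_ray (s : bool) (k l j : 'I_3)
    (u : set_type (@sigma R k)) (v : set_type (@sigma R l)) :
  [\/ [/\ k = idx0, l = idx1 & j = idx2], [/\ k = idx0, l = idx2 & j = idx1] |
      [/\ k = idx1, l = idx2 & j = idx0]] ->
  set_val u = set_val v -> ray (ray_gen R j) (set_val u) ->
  glued_incl s u = glued_incl (~~ s) v.
Proof.
move=> kl uv ru; apply: glued_incl_glue.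
by case: kl u v uv ru => -[-> -> ->] u v uv ru;
  [apply: Or31|apply: Or32|apply: Or33]; exists s.
Qed.

Lemma glued_incl0 (k l : 'I_3) (s r : bool)
    (u : set_type (@sigma R k)) (v : set_type (@sigma R l)) :
  set_val u = 0 -> set_val v = 0 -> glued_incl s u = glued_incl r v.
Proof.
have s0 (j : 'I_3) : 0 \in @sigma R j.
  by rewrite inE; case: (idxP j) => ->; exists 0, 0; split;
    rewrite // !scale0r addr0.
pose O (j : 'I_3) : set_type (@sigma R j) := exist _ 0 (s0 j).
have ray0 j : ray (ray_gen R j) 0 by exists 0; rewrite ?scale0r.
have O01 b : glued_incl b (O idx0) = glued_incl (~~ b) (O idx1).
  by apply: (@glued_incl_ray _ _ _ idx2); rewrite //; apply: Or31.
have O02 b : glued_incl b (O idx0) = glued_incl (~~ b) (O idx2).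
  by apply: (@glued_incl_ray _ _ _ idx1); rewrite //; apply: Or32.
have O12 b : glued_incl b (O idx1) = glued_incl (~~ b) (O idx2).
  by apply: (@glued_incl_ray _ _ _ idx0); rewrite //; apply: Or33.
(* Passing once through the cones 0, 1, 2 and back to 0 crosses three gluings, an odd number of sign
   changes. *)
have O0 b : glued_incl b (O idx0) = glued_incl (~~ b) (O idx0).
  by rewrite O01 O12 -O02.
have Oall (j : 'I_3) b : glued_incl b (O j) = glued_incl true (O idx0).
  have {}O0 c : glued_incl c (O idx0) = glued_incl true (O idx0).
    by case: c => //; rewrite O0.
  by case: (idxP j) => ->; [|rewrite -[b]negbK -O01|rewrite -[b]negbK -O02].
move=> u0 v0; have -> : u = O k by apply: val_inj.
by have -> : v = O l by [apply: val_inj]; rewrite !Oall.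
Qed.

Lemma ray0_mem (x : 'rV[R]_2) :
  0 <= xi1 x -> xi2 x = xi1 x -> ray (ray_gen R idx0) x.
Proof.
move=> x1 x2; exists (xi1 x) => //.
by apply: vec_ext; rewrite /ray_gen /= !xiE; lra.
Qed.

Lemma ray1_mem (x : 'rV[R]_2) :
  xi1 x <= 0 -> xi2 x = 0 -> ray (ray_gen R idx1) x.
Proof.
move=> x1 x2; exists (- xi1 x); first lra.
by apply: vec_ext; rewrite /ray_gen /= !xiE; lra.
Qed.

Lemma ray2_mem (x : 'rV[R]_2) :
  xi1 x = 0 -> xi2 x <= 0 -> ray (ray_gen R idx2) x.
Proof.
move=> x1 x2; exists (- xi2 x); first lra.
by apply: vec_ext; rewrite /ray_gen /= !xiE; lra.
Qed.

(** This is injectivity of the developing map on the quotient: equal images force the same plane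
    point, and every remaining coincidence must come from a gluing. *)
Lemma glued_incl_eq (k l : 'I_3) (s r : bool)
    (u : set_type (@sigma R k)) (v : set_type (@sigma R l)) :
  dev (k, s) (set_val u) = dev (l, r) (set_val v) ->
  glued_incl s u = glued_incl r v.
Proof.
move=> e.
have uv : set_val u = set_val v.
  by apply: (@dev_inj _ (k, s) (l, r)); [exact: sigmaP|exact: sigmaP|left].
have := sigmaP u; have := sigmaP v; rewrite -uv => /sigmaE lu /sigmaE ku.
have zero : xi1 (set_val u) = 0 -> xi2 (set_val u) = 0 ->
    glued_incl s u = glued_incl r v.
  move=> x1 x2; have u0 : set_val u = 0 by apply: vec_ext; rewrite !xiE.
  by apply: glued_incl0; rewrite -?uv.
rewrite -uv in e; have e1 := congr1 (@xi1 R) e; have e2 := congr1 (@xi2 R) e.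
clear e.
case: ku lu => -[ek [p1 p2]] [] [el [q1 q2]]; subst k l; destruct s, r;
rewrite /dev /dev_sign /dev_half /= !xiE in e1 e2.
(* The same cone with opposite signs, or distinct cones with equal signs, force the origin. What
   remains is the same sheet, or distinct cones with opposite signs, which are glued along their
   common ray. *)
all: try by apply: zero; lra.
all: try by congr glued_incl; exact: val_inj.
all: first
  [ by apply: (@glued_incl_ray _ _ _ idx2);
      [apply: Or31|exact: uv|apply: ray2_mem; lra]
  | by apply: (@glued_incl_ray _ _ _ idx1);
      [apply: Or32|exact: uv|apply: ray1_mem; lra]
  | by apply: (@glued_incl_ray _ _ _ idx0);
      [apply: Or33|exact: uv|apply: ray0_mem; lra]
  | by apply/esym/(@glued_incl_ray _ _ _ idx2);
      [apply: Or31|exact: esym uv|rewrite -uv; apply: ray2_mem; lra]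
  | by apply/esym/(@glued_incl_ray _ _ _ idx1);
      [apply: Or32|exact: esym uv|rewrite -uv; apply: ray1_mem; lra]
  | by apply/esym/(@glued_incl_ray _ _ _ idx0);
      [apply: Or33|exact: esym uv|rewrite -uv; apply: ray0_mem; lra]].
Qed.

Definition glued_dev (p : glued R) : 'rV[R]_2 :=
  dev (cone_index (repr p)) (cone_point (repr p)).

(** The two linear maps agree on multiples of the generator of each gluing ray, so the value is
    invariant under the generated equivalence. *)
Lemma glued_dev_incl (k : 'I_3) (s : bool) (u : set_type (@sigma R k)) :
  glued_dev (glued_incl s u) = dev (k, s) (set_val u).
Proof.
rewrite /glued_dev.
have glue_dev (p q : cones R) :
    clos_refl_sym_trans _ (@Defs.glue R) p q ->
    dev (cone_index p) (cone_point p) = dev (cone_index q) (cone_point q).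
  elim=> {p q} [p q|//|p q _ -> //|p q r _ -> _ -> //].
  by case=> -[b [-> -> <- [a _ ->]]]; apply: vec_ext; case: b;
    rewrite /dev /dev_sign /dev_half /ray_gen /= !xiE; ring.
exact: glue_dev (repr_glue _).
Qed.

Section GluedMap.
Variables (Z : topologicalType) (F : glued R -> Z)
  (h : 'I_3 * bool -> 'rV[R]_2 -> Z).
Hypothesis Fh : forall k s (u : set_type (@sigma R k)),
  F (glued_incl s u) = h (k, s) (set_val u).

Lemma glued_continuous : (forall ks, continuous (h ks)) -> continuous F.
Proof.
move=> ch; apply/quotient_continuous/continuousP => A oA.
apply/sigT_openP => -[k s].
have -> : existT _ (k, s) @^-1` ((F \o \pi_(glued R)) @^-1` A) =
    (set_val : set_type (@sigma R k) -> _) @^-1` (h (k, s) @^-1` A).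
  by apply/seteqP; split => u /=; rewrite /preimage /= -Fh.
exists (h (k, s) @^-1` A) => //.
by apply: open_comp => // x _; exact: ch.
Qed.

(** The image of a closed set is a union of six pieces, one per sheet, each the preimage under the
    continuous inverse [h' ks] of a closed subset of the cone. *)
Lemma glued_closed_map (h' : 'I_3 * bool -> Z -> 'rV[R]_2) :
  (forall ks, continuous (h' ks)) ->
  (forall ks, cancel (h ks) (h' ks)) -> (forall ks, cancel (h' ks) (h ks)) ->
  closed_map F.
Proof.
move=> ch hK hK' C cC.
(* The trace of [C] on each sheet is cut out by a closed set [D] of the plane, by the sum and
   subspace topologies. *)
have /choice[D DP] : forall ks, exists D, closed D /\
    forall u : set_type (@sigma R ks.1), C (glued_incl ks.2 u) <-> D (set_val u).
  move=> [k s] /=.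
  have : open (~` C) by exact: closed_openC.
  move=> /(sigT_openP (X := fun ks => set_type (@sigma R ks.1))).
  move=> /(_ (k, s)) [D oD DC].
  exists (~` D); split; first exact: open_closedC.
  move=> u; have /= := congr1 (@^~ u) DC; rewrite /preimage /= /setC /= => ->.
  by rewrite notK.
have -> : F @` C = \bigcup_ks (h' ks @^-1` (sigma ks.1 `&` D ks)).
  apply/seteqP; split => [_ [p + <-]|y [ks _ [sy Dy]]].
    have [[k s] [u ->]] := glued_inclP p => /= Cu.
    exists (k, s) => //; rewrite Fh /preimage /= hK; split; first exact: sigmaP.
    exact/(DP (k, s)).2.
  have sy' : h' ks y \in @sigma R ks.1 by rewrite inE.
  exists (glued_incl ks.2 (exist _ (h' ks y) sy')); first exact/(DP ks).2.
  by case: ks sy Dy sy' => k s /= sy Dy sy'; rewrite Fh hK'.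
apply: closed_bigcup => [|ks _]; first exact: finite_finset.
apply: preimage_closed => [y _|]; first exact: ch.
apply: closedI; first exact: sigma_closed.
by case: (DP ks).
Qed.

End GluedMap.
End Glued.

(** * The developing homeomorphism, the projection and the involution *)

Section Multisection.
Variable R : realType.

Lemma glued_dev_continuous : continuous (@glued_dev R).
Proof. exact: (glued_continuous (@glued_dev_incl R) (@dev_continuous R)). Qed.

Lemma glued_dev_closed : closed_map (@glued_dev R).
Proof.
exact: (glued_closed_map (@glued_dev_incl R) (@dev_inv_continuous R)
  (@devK R) (@dev_invK R)).
Qed.

Lemma glued_dev_inj : injective (@glued_dev R).
Proof.
move=> p q; have [[k s] [u ->]] := glued_inclP p.
have [[l r] [v ->]] := glued_inclP q.
by rewrite !glued_dev_incl; exact: glued_incl_eq.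
Qed.

Lemma glued_dev_surj (y : 'rV[R]_2) : exists p, glued_dev p = y.
Proof.
have [[k s] [x [kx xy]]] := dev_onto y.
have kx' : x \in @sigma R k by rewrite inE.
by exists (glued_incl s (exist _ x kx')); rewrite glued_dev_incl.
Qed.

Lemma glued_dev_bij : bijective (@glued_dev R).
Proof.
have /choice[g gK] := glued_dev_surj.
by exists g => // p; apply: glued_dev_inj.
Qed.

Lemma glued_dev_open : open_map (@glued_dev R).
Proof. exact: bij_closed_open_map glued_dev_bij glued_dev_closed. Qed.

Lemma glued_proj_continuous : continuous (@glued_proj R).
Proof.
apply: (@glued_continuous _ 'rV[R]_2 _ (fun=> id)) => [k s u|ks x].
  exact: glued_proj_incl.
exact: cvg_id.
Qed.

Lemma glued_proj_closed : closed_map (@glued_proj R).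
Proof.
apply: (@glued_closed_map _ 'rV[R]_2 _ (fun=> id) _ (fun=> id)) => // [k s u|ks x].
  exact: glued_proj_incl.
exact: cvg_id.
Qed.

Lemma sigma_cover (y : 'rV[R]_2) : exists k, sigma k y.
Proof.
case: (lerP 0 (xi1 y)) => y1; case: (lerP 0 (xi2 y)) => y2;
  case: (lerP (xi1 y) (xi2 y)) => y12;
  first [by exists idx0; apply/sigma0E; lra
        |by exists idx1; apply/sigma1E; lra
        |by exists idx2; apply/sigma2E; lra].
Qed.

Lemma glued_proj_surj (y : 'rV[R]_2) : exists p, glued_proj p = y.
Proof.
have [k] := sigma_cover y; rewrite -inE => ky.
by exists (glued_incl true (exist _ y ky)); rewrite glued_proj_incl.
Qed.

Lemma glued_proj0_dev0 (p : glued R) : glued_proj p = 0 -> glued_dev p = 0.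
Proof.
have [[k s] [u ->]] := glued_inclP p.
rewrite glued_proj_incl glued_dev_incl => ->.
by rewrite /dev; case: (idxP k) => ->; apply: vec_ext;
  rewrite /dev_half /= !xiE; ring.
Qed.

Lemma glued_phi_continuous : continuous (@glued_phi R).
Proof.
apply: (@glued_continuous _ R _ (@phi_lin R)) => [k s u|[k s]].
  exact: glued_phi_incl.
have c1 := @xi1_continuous R; have c2 := @xi2_continuous R.
by case: (idxP k) => ->; case: s; rewrite /phi_lin /=;
  first [exact: c1|exact: c2|exact: opp_fun_continuous|exact: sub_fun_continuous].
Qed.

(** Forward by [dev_overlap], backward by [dev_inj]. *)
Lemma glued_proj_fiber (p q : glued R) : glued_proj p = glued_proj q <->
  glued_dev q = glued_dev p \/ glued_dev q = - glued_dev p.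
Proof.
have [[k s] [u ->]] := glued_inclP p.
have [[l r] [v ->]] := glued_inclP q.
rewrite !glued_dev_incl !glued_proj_incl; split.
  move=> uv; rewrite -uv; apply: dev_overlap; first exact: sigmaP.
  by rewrite uv; exact: sigmaP.
move=> e; apply/esym/(@dev_inj _ (l, r) (k, s)) => //; exact: sigmaP.
Qed.

Lemma dense_setC_zero : dense (~` [set (0 : 'rV[R]_2)]).
Proof.
move=> O [x Ox] oO; have [x0|/eqP x0] := eqVneq x 0; last by exists x.
(* Small nonzero multiples of [(1, 1)] approach the origin. *)
have : nbhs (0 : R) [set r | O (r *: vec 1 1)].
  apply: (@scalel_continuous R 'rV[R]_2 (vec 1 1)); rewrite scale0r -x0.
  exact: open_nbhs_nbhs.
move=> /nbhs_ballP[e /= e0 eO]; exists ((e / 2) *: vec 1 1); split.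
  apply: eO; rewrite /ball /= sub0r normrN gtr0_norm; lra.
by move=> /(congr1 (@xi1 R)); rewrite !xiE; lra.
Qed.

(** Negation of the plane, transported to L. The default [p] is never taken, as [glued_dev] is
    onto. *)
Definition glued_flip (p : glued R) : glued R :=
  xget p [set q | glued_dev q = - glued_dev p].

Lemma glued_dev_flip p : glued_dev (glued_flip p) = - glued_dev p.
Proof.
have [q qp] := glued_dev_surj (- glued_dev p).
by rewrite /glued_flip; case: xgetP => [z _ //|/(_ q)].
Qed.

Lemma glued_flip_continuous : continuous glued_flip.
Proof.
apply/continuousP => A oA.
(* Continuity of the flip is thereby reduced to openness of [glued_dev]. *)
have -> : glued_flip @^-1` A =
    (fun p => - glued_dev p) @^-1` (@glued_dev R @` A).
  apply/seteqP; split => p /=; rewrite /preimage /=.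
    by exists (glued_flip p); rewrite ?glued_dev_flip.
  by case=> q Aq; rewrite -glued_dev_flip => /glued_dev_inj <-.
apply: open_comp; last exact: glued_dev_open.
move=> p _; apply: continuousN; exact: glued_dev_continuous.
Qed.

End Multisection.

Theorem proposition3p3 (R : realType) :
  @tropical_Lagrangian_multisection R 2 (std_affine R 2) 2 (glued R)
    (@glued_proj R) (restrictions (@glued_phi R)).
Proof.
have [p0 proj0] := glued_proj_surj (0 : 'rV[R]_2).
have p00 := glued_proj0_dev0 proj0.
(* A fixed point has a developing coordinate equal to its own negative, hence zero. *)
have fixE : [set p | glued_flip p = p] = [set p0].
  apply/seteqP; split => p /= => [e|->]; apply: glued_dev_inj.
    have := glued_dev_flip p; rewrite e p00 => {}e.
    by apply: vec_ext; have := congr1 (@xi1 R) e; have := congr1 (@xi2 R) e;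
      rewrite !xiE; lra.
  by rewrite glued_dev_flip p00 oppr0.
have fib p q : glued_proj p = glued_proj q <-> q = p \/ q = glued_flip p.
  split=> [/glued_proj_fiber[e|e]|e].
  - by left; exact: glued_dev_inj.
  - by right; apply: glued_dev_inj; rewrite glued_dev_flip.
  - apply/glued_proj_fiber; case: e => ->; first by left.
    by right; rewrite glued_dev_flip.
have manL := global_chart_manifold (@glued_dev_continuous R)
  (@glued_dev_open R) (@glued_dev_inj R).
have hL : hausdorff_space (glued R) by case: manL.
have dns : dense (~` (@glued_proj R @` [set p | glued_flip p = p])).
  by rewrite fixE image_set1 proj0; exact: dense_setC_zero.
have ram : ramification_locus (@glued_proj R) = [set p0].
  rewrite -fixE; exact: (involution_quotient_ramification hL
    (@glued_proj_continuous R) (@glued_flip_continuous R) (@glued_proj_surj R)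
    (@glued_proj_closed R)).
split => //.
- exact: (involution_quotient_branched_covering hL
    (@glued_proj_continuous R) (@glued_flip_continuous R) (@glued_proj_surj R)
    (@glued_proj_closed R)).
- rewrite /branch_locus ram image_set1 proj0.
  (* The branch locus is the origin, centred in the identity chart; the ramification locus is [p0],
     centred in the chart [glued_dev]. *)
  apply: (@point_union_of_submanifolds R 2 'rV[R]_2 id) => //.
    by move=> x; exact: cvg_id.
  by move=> U; rewrite image_id.
- rewrite ram.
  exact: (point_union_of_submanifolds (@glued_dev_continuous R)
    (@glued_dev_open R) (@glued_dev_inj R)).
- split; last exact: integral_affine_differences_restrictions.
  split; last first.
    by rewrite eqEsubset; split => // p _; exists setT => //; exact: openT.
  move=> U oU; split => //; apply: continuous_subspaceT.
  exact: glued_phi_continuous.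
Qed.
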